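(* Let $F$ be a field and let $H$ be an $F$-algebra satisfying condition (A) or condition (B). Let $\kappa,\kappa'\colon H\wedge H\to H/F$ be the unique $F$-linear maps with $(g\wedge h)^{\kappa}=\overline{g}\,h+F$ and $(g\wedge h)^{\kappa'}=g\,\overline{h}+F$ for all $g,h\in H$, and put $C:=\ker\kappa$, $C':=\ker\kappa'$ (both are planes of $\mathbb{P}(H\wedge H)$). Then the plane $C$ has no point in common with the Klein quadric $\mathcal{Q}$ of $\mathbb{P}(H\wedge H)$, and the canonical Clifford parallelism $\parallel_L$ of $\mathbb{P}(H)$ coincides with the parallelism $\parallel_C$. Similarly, the plane $C'$ has no point in common with $\mathcal{Q}$, and the canonical Clifford parallelism $\parallel_R$ of $\mathbb{P}(H)$ coincides with the parallelism $\parallel_{C'}$. Furthermore, $C$ and $C'$ are mutually polar under the polarity of the Klein quadric, i.e. $C'=C^\perp$.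
   Context: Fields are commutative and of arbitrary characteristic. For a vector space $U$ over $F$, $\mathbb{P}(U)$ is the projective space of all subspaces of $U$; points, lines, planes are the subspaces of vector dimension $1,2,3$. Conditions on an $F$-algebra $H$ (with $F$ identified with $F\cdot 1_H$): (A) $H$ is a quaternion skew field with centre $F$ (so $[H:F]=4$); (B) $H$ is an extension field of $F$ with $[H:F]=4$ and $h^2\in F$ for all $h\in H$. The conjugation $\overline{\phantom{a}}\colon H\to H$ is the standard quaternion conjugation in case (A) (the $F$-linear antiautomorphism with $h\overline h=\overline h h\in F$, $h+\overline h\in F$ and $h^2-(h+\overline h)h+h\overline h=0$ for all $h\in H$), and the identity mapping in case (B). $H/F$ denotes the quotient $F$-vector space of $H$ modulo its subspace $F$. The maps $(g,h)\mapsto \overline g h+F$ and $(g,h)\mapsto g\overline h+F$ are alternating $F$-bilinear, so $\kappa$ and $\kappa'$ exist and are unique. Lines $M,N$ of $\mathbb{P}(H)$ (two-dimensional $F$-subspaces of $H$) are left parallel, $M\parallel_L N$, if $cM=N$ for some $c\in H\setminus\{0\}$, and right parallel, $M\parallel_R N$, if $Mc=N$ for some $c\in H\setminus\{0\}$. These are the canonical Clifford parallelisms of $\mathbb{P}(H)$. The Plücker embedding $\gamma$ maps a line $M$ of $\mathbb{P}(H)$ to the point $M^\gamma=F(u\wedge v)$ of $\mathbb{P}(H\wedge H)$, where $u,v$ is any basis of $M$; the Klein quadric $\mathcal{Q}$ is the image of $\gamma$. The polarity $\perp$ of the Klein quadric sends a subspace $X\subset H\wedge H$ to $X^\perp=\{y\in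 H\wedge H\mid x\wedge y=0\text{ in }\bigwedge^4 H\text{ for all }x\in X\}$. For a plane $C$ of $\mathbb{P}(H\wedge H)$ having no point in common with $\mathcal{Q}$, lines $M,N$ satisfy $M\parallel_C N$ if $C+M^\gamma=C+N^\gamma$; this relation is a parallelism (an equivalence relation on lines such that each point lies on precisely one line from each equivalence class). *)

(* Defs.v *)
From HB Require Import structures.
From mathcomp Require Import all_boot all_order all_algebra all_field.

Set Implicit Arguments.
Unset Strict Implicit.
Unset Printing Implicit Defensive.

Import GRing.Theory.
Local Open Scope ring_scope.
Local Open Scope quotient_scope.

Section QuotientSpace.

Variables (K : fieldType) (V : vectType K) (U : {vspace V}).

Definition quotv := Quotient.quot U.

HB.instance Definition _ := ZmodQuotient.on quotv.

Definition quotv_scale (a : K) := lift_op1 quotv ( *:%R a).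

Lemma pi_quotv_scale a : {morph \pi_quotv : x / a *: x >-> quotv_scale a x}.
Proof.
move=> x; unlock quotv_scale; apply/eqP; rewrite -Quotient.idealrBE -scalerBr.
by rewrite rpredZ // Quotient.idealrBE reprK.
Qed.

Fact quotv_scalerA a b v :
  quotv_scale a (quotv_scale b v) = quotv_scale (a * b) v.
Proof. by rewrite -[v]reprK -!pi_quotv_scale scalerA. Qed.

Fact quotv_scale1r : left_id 1 quotv_scale.
Proof. by move=> v; rewrite -[v]reprK -!pi_quotv_scale scale1r. Qed.

Fact quotv_scalerDr : right_distributive quotv_scale +%R.
Proof.
move=> a u v; rewrite -[u]reprK -[v]reprK -[in LHS]raddfD /=.
by rewrite -!pi_quotv_scale scalerDr raddfD.
Qed.

Fact quotv_scalerDl v : {morph quotv_scale^~ v : a b / a + b}.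
Proof.
by move=> a b; rewrite -[v]reprK -!pi_quotv_scale scalerDl raddfD.
Qed.

HB.instance Definition _ := GRing.Zmodule_isLmodule.Build K quotv
  quotv_scalerA quotv_scale1r quotv_scalerDr quotv_scalerDl.

Definition quotv_proj : V -> quotv := \pi_quotv.

Fact quotv_proj_is_linear : linear quotv_proj.
Proof. by move=> a u v; rewrite /quotv_proj raddfD /= pi_quotv_scale. Qed.

HB.instance Definition _ := GRing.isSemilinear.Build K V quotv _ quotv_proj
  (GRing.semilinear_linear quotv_proj_is_linear).

Lemma quotv_proj_eq0 v : (quotv_proj v == 0) = (v \in U).
Proof. by rewrite -[0](raddf0 quotv_proj) -Quotient.idealrBE subr0. Qed.

Fact quotv_vect_iso : Vector.axiom (\dim U^C) quotv.
Proof.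
pose b := vbasis U^C; pose p := daddv_pi U^C U.
have tiUC : (U^C :&: U = 0)%VS by rewrite capvC capv_compl.
have p_add v : p v + daddv_pi U U^C v = v.
  by apply: daddv_pi_add => //; rewrite addvC addv_complf memvf.
have p_eq0 v : v \in U -> p v = 0.
  move=> Uv; apply/(addIr (daddv_pi U U^C v)).
  by rewrite p_add add0r daddv_pi_id ?capv_compl.
have p_proj v : quotv_proj (p v) = quotv_proj v.
  apply/eqP; rewrite -subr_eq0 -raddfB quotv_proj_eq0 -[X in _ - X]p_add.
  by rewrite opprD addrA subrr add0r rpredN memv_pi.
have p_eq u v : quotv_proj u = quotv_proj v -> p u = p v.
  move/eqP; rewrite -subr_eq0 -raddfB quotv_proj_eq0 => /p_eq0/eqP.
  by rewrite raddfB subr_eq0 => /eqP.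
have p_repr v : p (repr (quotv_proj v)) = p v.
  by apply: p_eq; rewrite /quotv_proj reprK.
exists (fun x : quotv => \row_i coord b i (p (repr x))).
  have reprE (x : quotv) : x = quotv_proj (repr x) by rewrite /quotv_proj reprK.
  move=> a x y; rewrite (reprE x) (reprE y) -linearP.
  by apply/rowP=> i; rewrite !mxE !p_repr !linearP.
exists (fun c : 'rV[K]_(\dim U^C) => quotv_proj (\sum_i c 0 i *: b`_i)).
  move=> x; under eq_bigr do rewrite mxE.
  by rewrite -coord_vbasis ?memv_pi // p_proj /quotv_proj reprK.
move=> c; apply/rowP=> i; rewrite mxE p_repr daddv_pi_id //.
  by rewrite coord_sum_free // (basis_free (vbasisP _)).
by apply: rpred_sum => j _; rewrite rpredZ // vbasis_mem ?mem_nth ?size_tuple.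
Qed.

HB.instance Definition _ :=
  Lmodule_hasFinDim.Build K quotv quotv_vect_iso.

End QuotientSpace.

Section ExteriorPower.

Variables (K : fieldType) (V : vectType K).

Definition kset (k : nat) := {S : {set 'I_(\dim {:V})} | #|S| == k}.

(* The standard coordinate model of the k-th exterior power. With e the basis *)
(* vbasis {:V} of V, x S is the coordinate of x at the wedge product, in      *)
(* increasing order of index, of the e`_i for i in S.                         *)
Definition extpow (k : nat) := {ffun kset k -> K^o}.

HB.instance Definition _ k := Vector.on (extpow k).

Definition ext1 (v : V) : extpow 1 :=
  [ffun S : kset 1 => \sum_(i in val S) coord (vbasis {:V}) i v].

Definition inversions n (A B : {set 'I_n}) : nat :=
  #|[set p : 'I_n * 'I_n | [&& p.1 \in A, p.2 \in B & (p.2 < p.1)%N]]|.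

(* e_A /\ e_B = (-1)^(inversions A B) e_(A :|: B) for disjoint A, B, else 0.  *)
Definition extmul j k (x : extpow j) (y : extpow k) : extpow (j + k)%N :=
  [ffun S : kset (j + k)%N =>
    \sum_(A : kset j) \sum_(B : kset k |
        [disjoint val A & val B] && (val A :|: val B == val S))
      (-1) ^+ inversions (val A) (val B) * (x A * y B)].

Fact extmul_is_linear j k (x : extpow j) : linear (@extmul j k x).
Proof.
move=> a y z; apply/ffunP=> S; rewrite !ffunE scaler_sumr -big_split /=.
apply: eq_bigr => A _; rewrite scaler_sumr -big_split /=.
apply: eq_bigr => B _; rewrite !ffunE -![_ *: _]/(_ * _).
by rewrite !mulrDr !(mulrCA a).
Qed.

HB.instance Definition _ j k x :=
  GRing.isSemilinear.Build K (extpow k) (extpow (j + k)%N) _ (@extmul j k x)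
    (GRing.semilinear_linear (@extmul_is_linear j k x)).

Fact extmul_is_linearl j k (y : extpow k) : linear ((@extmul j k)^~ y).
Proof.
move=> a x z; apply/ffunP=> S; rewrite !ffunE scaler_sumr -big_split /=.
apply: eq_bigr => A _; rewrite scaler_sumr -big_split /=.
apply: eq_bigr => B _; rewrite !ffunE -![_ *: _]/(_ * _).
by rewrite !mulrDl !mulrDr -!mulrA !(mulrCA a).
Qed.

Fact ext1_is_linear : linear ext1.
Proof.
move=> a u v; apply/ffunP=> S; rewrite !ffunE scaler_sumr -big_split /=.
by apply: eq_bigr => i _; rewrite linearP.
Qed.

HB.instance Definition _ :=
  GRing.isSemilinear.Build K V (extpow 1) _ ext1
    (GRing.semilinear_linear ext1_is_linear).

Definition wedge (u v : V) : extpow 2 := extmul (ext1 u) (ext1 v).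

Lemma wedge_linearl a u w v : wedge (a *: u + w) v = a *: wedge u v + wedge w v.
Proof. by rewrite /wedge linearP extmul_is_linearl. Qed.

Lemma wedge_linearr a u v w : wedge u (a *: v + w) = a *: wedge u v + wedge u w.
Proof. by rewrite /wedge !linearP. Qed.

Lemma wedgexx u : wedge u u = 0.
Proof.
apply/ffunP=> S; rewrite !ffunE.
have card1 i : #|[set i] : {set 'I_(\dim {:V})}| == 1 by rewrite cards1.
pose s i : kset 1 := Sub [set i] (card1 i).
have s_bij : bijective s.
  apply: inj_card_bij => [i j /(congr1 val)/= /set1_inj //|].
  have := card_draws 'I_(\dim {:V}) 1; rewrite bin1 => <-.
  by rewrite card_sig cardsE.
have s_on : {on [pred _ | true], bijective s} by apply: onW_bij.
rewrite (reindex s s_on) /=.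
under eq_bigr => i _ do rewrite (reindex s (onW_bij _ s_bij)) /=.
rewrite pair_big_dep /=.
rewrite (bigID (fun p : 'I_(\dim {:V}) * 'I_(\dim {:V}) => p.1 < p.2)%N) /=.
pose sw (p : 'I_(\dim {:V}) * 'I_(\dim {:V})) := (p.2, p.1).
have swK : involutive sw by case.
rewrite [X in _ + X](reindex_inj (inv_inj swK)) /=.
rewrite [X in _ + X](eq_bigl (fun p : 'I_(\dim {:V}) * 'I_(\dim {:V}) =>
    ([disjoint [set p.1] & [set p.2]] && ([set p.1] :|: [set p.2] == val S))
    && (p.1 < p.2)%N)); last first.
  case=> i j /=; rewrite disjoint_sym setUC.
  by case: ltngtP => // /val_inj ->; rewrite disjoints1 inE eqxx.
rewrite -big_split big1 //= => -[i j] /andP[_ /= ltij].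
have inv0 : inversions [set i] [set j] = 0%N.
  apply: eq_card0 => -[a b]; rewrite !inE /=.
  by case: eqP => //= ->; case: eqP => //= ->; rewrite ltnNge ltnW.
have inv1 : inversions [set j] [set i] = 1%N.
  rewrite -(cards1 (j, i)); apply: eq_card => -[a b]; rewrite !inE /=.
  rewrite xpair_eqE; case: eqP => //= ->; case: eqP => //= ->.
  by rewrite ltij.
by rewrite inv0 inv1 expr0 expr1 mul1r mulN1r mulrC subrr.
Qed.

Lemma wedgeC u v : wedge u v = - wedge v u.
Proof.
have := wedgexx (1 *: u + v); rewrite wedge_linearl !wedge_linearr !wedgexx.
by rewrite scaler0 addr0 add0r !scale1r => /eqP; rewrite addr_eq0 => /eqP.
Qed.

(* The image of a line M under the Pluecker embedding. By plueckerE below it  *)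
(* does not depend on the choice of the basis of M.                           *)
Definition pluecker (M : {vspace V}) : {vspace extpow 2} :=
  <[wedge (vbasis M)`_0 (vbasis M)`_1]>%VS.

Lemma plueckerE (M : {vspace V}) u v :
  basis_of M [:: u; v] -> pluecker M = <[wedge u v]>%VS.
Proof.
have sub (L : {vspace V}) a b c d : basis_of L [:: a; b] ->
    c \in L -> d \in L -> (<[wedge c d]> <= <[wedge a b]>)%VS.
  move=> bL; rewrite -(span_basis bL).
  have in2 x : x \in <<[:: a; b]>>%VS -> exists p q, x = p *: a + (q *: b + 0).
    rewrite span_cons span_seq1 => /memv_addP[_ /vlineP[p ->]].
    by case=> _ /vlineP[q ->] ->; exists p, q; rewrite addr0.
  move=> /in2[p [q ->]] /in2[r [t ->]]; rewrite -memvE.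
  have w0l x : wedge 0 x = 0.
    have := wedge_linearl 1 0 0 x; rewrite scale1r addr0 scale1r.
    by move/(canLR (addrK _)); rewrite subrr.
  have w0r x : wedge x 0 = 0 by rewrite wedgeC w0l oppr0.
  rewrite !wedge_linearl w0l !wedge_linearr !w0r !wedgexx [wedge b a]wedgeC.
  rewrite !scaler0 !addr0 !add0r.
  by rewrite !scalerN rpredB ?rpredZ ?memv_line.
move=> bM; have szM : size (vbasis M) = 2.
  by rewrite size_tuple (@size_basis _ _ _ _ [tuple u; v] bM).
have def_b : vbasis M = [:: (vbasis M)`_0; (vbasis M)`_1] :> seq V.
  by case: (tval (vbasis M)) szM => [|x [|y []]].
have bM' : basis_of M [:: (vbasis M)`_0; (vbasis M)`_1].
  by rewrite -def_b vbasisP.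
have /andP[uM vM] : (u \in M) && (v \in M).
  by apply/andP; split; apply: (basis_mem bM); rewrite !inE eqxx ?orbT.
apply/eqP; rewrite eqEsubv (sub _ _ _ _ _ bM') // (sub _ _ _ _ _ bM) //.
  by rewrite vbasis_mem // mem_nth ?szM.
by rewrite vbasis_mem // mem_nth ?szM.
Qed.

Definition klein_quadric (P : {vspace extpow 2}) : Prop :=
  exists2 M : {vspace V}, \dim M = 2%N & P = pluecker M.

Definition polar (X : {vspace extpow 2}) : {vspace extpow 2} :=
  (\bigcap_(x <- vbasis X) lker (linfun (extmul x)))%VS.

Lemma memv_polarP (X : {vspace extpow 2}) (y : extpow 2) :
  reflect (forall x, x \in X -> extmul x y = 0) (y \in polar X).
Proof.
have mul0 : extmul (0 : extpow 2) y = 0.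
  by apply/ffunP=> S; rewrite !ffunE big1 // => A _; rewrite big1 // => B _;
     rewrite ffunE mul0r mulr0.
have -> : (y \in polar X) = all (fun x => extmul x y == 0) (vbasis X).
  rewrite /polar; elim: (tval _) => [|x s IHs]; first by rewrite big_nil memvf.
  by rewrite big_cons memv_cap IHs memv_ker lfunE.
apply: (iffP allP) => [Xy x Xx|Xy x Xx]; last by rewrite Xy ?vbasis_mem.
rewrite (coord_vbasis Xx).
elim/big_ind: _ => // [u v u0 v0 | i _].
  by rewrite -[u]scale1r extmul_is_linearl u0 v0 scaler0 addr0.
rewrite -[_ *: _]addr0 extmul_is_linearl mul0 addr0.
by rewrite (eqP (Xy _ _)) ?scaler0 // mem_nth ?size_tuple.
Qed.

Definition clifford_parallel (C : {vspace extpow 2}) (M N : {vspace V}) : Prop :=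
  (C + pluecker M = C + pluecker N)%VS.

End ExteriorPower.

Section CanonicalClifford.

Variables (F : fieldType) (H : falgType F).

Definition skew_field := forall x : H, x != 0 -> x \is a GRing.unit.

Definition quaternion_skew_field : Prop :=
  [/\ skew_field, 'Z({:H})%VS = 1%VS & \dim {:H} = 4%N].

Definition quaternion_conj (bar : 'End(H)) : Prop :=
  [/\ bijective bar, {morph bar : g h / g * h >-> h * g} &
      forall h, [/\ bar h * h = h * bar h, h * bar h \in 1%VS,
                    h + bar h \in 1%VS &
                    h ^+ 2 - (h + bar h) * h + h * bar h = 0]].

(* This forces F to have characteristic 2 and H / F to be purely inseparable. *)
Definition square_root_extension : Prop :=
  [/\ skew_field, commutative (@GRing.mul H), \dim {:H} = 4%N &
      forall h : H, h ^+ 2 \in 1%VS].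

Definition canonical_conj (bar : 'End(H)) : Prop :=
     quaternion_skew_field /\ quaternion_conj bar
  \/ square_root_extension /\ bar = \1%VF.

Definition left_parallel (M N : {vspace H}) : Prop :=
  exists2 c : H, c != 0 & (amull c @: M)%VS = N.

Definition right_parallel (M N : {vspace H}) : Prop :=
  exists2 c : H, c != 0 & (amulr c @: M)%VS = N.

End CanonicalClifford.

(* Main.v *)
Require Import Defs.
From HB Require Import structures.
From mathcomp Require Import all_boot all_order all_algebra all_field ring.

Set Implicit Arguments.
Unset Strict Implicit.
Unset Printing Implicit Defensive.

Import GRing.Theory.
Local Open Scope ring_scope.

(** The two cases are treated together, through common properties of the
conjugation: it is an injective linear antimorphism for which
[bar h * h = h * bar h] and [h + bar h] are scalars ([canonical_conjP]; in the
commutative case [h + h = (h + 1)^2 - h^2 - 1] is a scalar because squares are).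

Parallelism.  The maps kappa and [- kappa'] send [u /\ v] to the classes of
[q u v], where [q u] is left, respectively right, multiplication by [bar u].
Let [M] be a line and [u] a nonzero vector of [M].  Then [q u] maps [M] to a
two-dimensional space that contains the scalar [q u u], and the image of the
Pluecker point of [M] under kappa is the image of [q u M] in [H / F]
([pluecker_img]).  This image is nonzero, so that the kernel [C] misses the
Klein quadric; and since [C + <x>] is determined by the image of [x], the lines
[M] and [N] are [C]-parallel if and only if [q u M = q w N], with [w] a nonzero
vector of [N] ([clifford_parallelE]).  As [bar u] is a scalar multiple of the
inverse of [u], the space [bar u * M] is the line through 1 that is left
parallel to [M], which settles the comparison with the canonical parallelism.

Polarity.  The product of [u /\ v - 1 /\ bar u v], which is in [C], and
[x /\ y - 1 /\ y bar x], which is in [C'], is an alternating 4-form in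
[u, v, x, y] that vanishes as soon as one argument is 1; hence it is zero,
because [H / F] has dimension 3 ([alt4_vanish]).  The computation behind this is
that the form vanishes for [u = x] ([wedge_trace]): with [K = F(x)], it says
that the multiplication by [x] on the two-dimensional [F]-space [H / K] has
trace [x + bar x].  As these vectors span [C] and [C'] ([lker_sub]), the two
planes are orthogonal.  Both are complements of the totally isotropic plane
[1 /\ H], and the wedge pairing is nondegenerate, whence each is the polar of
the other ([polar_complement]). *)

(** * Alternating multilinear maps *)

Section Bilin.
Variables (K : fieldType) (V W : vectType K).

Lemma linfunE (g : V -> W) : linear g -> linfun g =1 g.
Proof.
move=> gP; pose G := HB.pack_for {linear V -> W} g
  (GRing.isSemilinear.Build K V W _ g (GRing.semilinear_linear gP)).
by move=> v; apply: (lfunE G).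
Qed.

Lemma eq_linear_basis (g h : V -> W) : linear g -> linear h ->
  (forall i, g (vbasis {:V})`_i = h (vbasis {:V})`_i) -> g =1 h.
Proof.
move=> gP hP gh v; rewrite -(linfunE gP) -(linfunE hP).
rewrite (coord_vbasis (memvf v)) !linear_sum; apply: eq_bigr => i _.
by rewrite !linearZ /= (linfunE gP) (linfunE hP) gh.
Qed.

Lemma alternating_skew (b : V -> V -> W) : (forall u, linear (b u)) ->
    (forall v, linear (b^~ v)) -> (forall u, b u u = 0) ->
  forall u v, b u v = - b v u.
Proof.
move=> br bl b0 u v; have := b0 (1 *: u + v).
rewrite bl !br !b0 !scale1r addr0 add0r.
by move/eqP; rewrite addr_eq0 => /eqP.
Qed.

End Bilin.

Section Alt4.
Variables (K : fieldType) (V W : vectType K).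

Lemma linear_span0 (g : V -> W) (s : seq V) y : linear g ->
  (forall t, t \in s -> g t = 0) -> y \in <<s>>%VS -> g y = 0.
Proof.
move=> gP g0 sy; apply/eqP; rewrite -(linfunE gP) -memv_ker.
move: y sy; apply/subvP/span_subvP => t st.
by rewrite memv_ker (linfunE gP) g0.
Qed.

Definition alternating4 (B : V -> V -> V -> V -> W) : Prop :=
  [/\ [/\ forall b c d, linear (fun a => B a b c d),
          forall a c d, linear (fun b => B a b c d),
          forall a b d, linear (fun c => B a b c d) &
          forall a b c, linear (fun d => B a b c d)],
      forall a c d, B a a c d = 0,
      forall a b d, B a b b d = 0 &
      forall a b c, B a b c c = 0].

Variable B : V -> V -> V -> V -> W.
Hypothesis altB : alternating4 B.

Lemma alt4C12 a b c d : B a b c d = - B b a c d.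
Proof.
by case: altB => -[? ? ? ?] ? _ _;
  apply: (alternating_skew (b := fun a b => B a b c d)).
Qed.

Lemma alt4C23 a b c d : B a b c d = - B a c b d.
Proof.
by case: altB => -[? ? ? ?] _ ? _;
  apply: (alternating_skew (b := fun b c => B a b c d)).
Qed.

Lemma alt4C34 a b c d : B a b c d = - B a b d c.
Proof.
by case: altB => -[? ? ? ?] _ _ ?;
  apply: (alternating_skew (b := fun c d => B a b c d)).
Qed.

(** A linear relation between the five vectors [o, a, b, c, d] of a space of
dimension at most 4 expresses one of [a, b, c, d] through [o] and earlier
arguments of the form, and each of these makes the form vanish. *)
Lemma alt4_vanish (o : V) : (\dim {:V} <= 4)%N -> o != 0 ->
  (forall b c d, B o b c d = 0) -> forall a b c d, B a b c d = 0.
Proof.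
move=> dV o0 Bo a b c d; case: altB => -[l1 l2 l3 l4] B12 B23 B34.
have Bo2 x y z : B x o y z = 0 by rewrite alt4C12 Bo oppr0.
have Bo3 x y z : B x y o z = 0 by rewrite alt4C23 Bo2 oppr0.
have Bo4 x y z : B x y z o = 0 by rewrite alt4C34 Bo3 oppr0.
have : ~~ free [:: d; c; b; a; o].
  apply: contraL dV => /eqnP /= dim5; rewrite -ltnNge.
  by have := dimvS (subvf <<[:: d; c; b; a; o]>>%VS); rewrite dim5.
rewrite !free_cons nil_free !negb_and !negbK span_nil memv0 (negbTE o0) orbF.
case/or4P => [dep|dep|dep|dep].
- apply: (linear_span0 (l4 a b c) _ dep) => t; rewrite !inE.
  case/or4P => /eqP-> //; first by rewrite alt4C34 B23 oppr0.
  by rewrite alt4C34 alt4C23 B12 !oppr0.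
- apply: (linear_span0 (l3 a b d) _ dep) => t; rewrite !inE.
  by case/or3P => /eqP-> //; rewrite alt4C23 B12 oppr0.
- apply: (linear_span0 (l2 a c d) _ dep) => t; rewrite !inE.
  by case/orP => /eqP->.
apply: (linear_span0 (l1 b c d) _ dep) => t; rewrite !inE.
by move/eqP->.
Qed.

End Alt4.

(** * The exterior product *)

Fact extmulA_signl (K : fieldType) (a b c p q r : K) :
  a * b * (c * (p * q) * r) = c * a * b * (p * q * r).
Proof. by ring. Qed.

Fact extmulA_signr (K : fieldType) (a b c p q r : K) :
  a * b * c * (p * q * r) = a * b * (p * (c * (q * r))).
Proof. by ring. Qed.

Section ExteriorAlgebra.

Variables (K : fieldType) (V : vectType K).

Local Notation n := (\dim {:V}).
Local Notation e := (vbasis {:V}).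

Lemma big_kset1 m k (T : {set 'I_n}) (G : {set 'I_n} -> K) :
  #|T| = m -> m = k -> \sum_(A : kset V k | T == val A) G (val A) = G T.
Proof.
move=> <- mk; have cT : #|T| == k by rewrite mk.
by rewrite (big_pred1 (Sub T cT : kset V k)).
Qed.

Lemma inversionsUl m (A B C : {set 'I_m}) : [disjoint A & B] ->
  inversions (A :|: B) C = (inversions A C + inversions B C)%N.
Proof.
move=> dAB; rewrite /inversions -cardsUI -[LHS]addn0; congr (_ + _)%N.
  by apply: eq_card => -[a b]; rewrite !inE /= andb_orl.
apply/esym/eqP; rewrite cards_eq0 -subset0; apply/subsetP=> -[a b].
rewrite !inE /= => /andP[/andP[aA _] /andP[aB _]].
by rewrite (disjointFr dAB aA) in aB.
Qed.

Lemma inversionsUr m (A B C : {set 'I_m}) : [disjoint B & C] ->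
  inversions A (B :|: C) = (inversions A B + inversions A C)%N.
Proof.
move=> dBC; rewrite /inversions -cardsUI -[LHS]addn0; congr (_ + _)%N.
  by apply: eq_card => -[a b]; rewrite !inE /= andb_orl andb_orr.
apply/esym/eqP; rewrite cards_eq0 -subset0; apply/subsetP=> -[a b].
rewrite !inE /= => /andP[/and3P[_ bB _] /and3P[_ bC _]].
by rewrite (disjointFr dBC bB) in bC.
Qed.

(** Both sides are the sum, over the decompositions of [S] into disjoint sets
[A1], [A2], [B], of the same term, since the number of inversions is additive in
each argument.  The two degrees are equal but not convertible for variable [j],
[k], [l], hence the two indices [S] and [S']. *)
Lemma extmulA j k l (x : extpow V j) (y : extpow V k) (z : extpow V l)
    (S : kset V (j + k + l)) (S' : kset V (j + (k + l))) :
  val S = val S' -> extmul (extmul x y) z S = extmul x (extmul y z) S'.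
Proof.
move=> eqS; rewrite !ffunE.
pose dj3 (A1 : kset V j) (A2 : kset V k) (B : kset V l) :=
  [&& [disjoint val A1 & val A2], [disjoint val A1 & val B],
      [disjoint val A2 & val B] &
      val A1 :|: val A2 :|: val B == val S].
pose sg3 (A1 : kset V j) (A2 : kset V k) (B : kset V l) : K :=
  (-1) ^+ (inversions (val A1) (val A2) + inversions (val A1) (val B)
           + inversions (val A2) (val B)) * (x A1 * y A2 * z B).
transitivity (\sum_A1 \sum_A2 \sum_(B | dj3 A1 A2 B) sg3 A1 A2 B).
  under eq_bigr => A _ do under eq_bigr => B _ do rewrite !ffunE.
  pose t (A : {set 'I_n}) (A1 : kset V j) (A2 : kset V k) (B : kset V l) : K :=
    ((-1) ^+ inversions A (val B) *
       ((-1) ^+ inversions (val A1) (val A2) * (x A1 * y A2) * z B)) *+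
     (([disjoint A & val B] && (A :|: val B == val S))).
  transitivity (\sum_(A : kset V (j + k)) \sum_(A1 : kset V j)
       \sum_(A2 : kset V k |
       [disjoint val A1 & val A2] && (val A1 :|: val A2 == val A)) \sum_B
       t (val A) A1 A2 B).
    apply: eq_bigr => A _; rewrite big_mkcond /=.
    under [RHS]eq_bigr => A1 _ do rewrite exchange_big /=.
    rewrite [RHS]exchange_big /=; apply: eq_bigr => B _.
    rewrite /t; case: ifP => _; last by rewrite big1 // => A1 _; rewrite big1.
    rewrite mulr_suml mulr_sumr; apply: eq_bigr => A1 _.
    by rewrite mulr_suml mulr_sumr; apply: eq_bigr => A2 _.
  rewrite exchange_big /=; apply: eq_bigr => A1 _.
  rewrite (exchange_big_dep predT) //=; apply: eq_bigr => A2 _.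
  case dA: [disjoint val A1 & val A2]; last first.
    by rewrite !big_pred0 // => B; rewrite /dj3 dA.
  rewrite /= (big_kset1 (fun A => \sum_B t A A1 A2 B) (erefl _)); last first.
    move: dA; rewrite -leq_card_setU => /eqP->.
    by rewrite (eqP (valP A1)) (eqP (valP A2)).
  rewrite [RHS]big_mkcond; apply: eq_bigr => B _; rewrite /t /dj3 dA /= /sg3.
  have -> : [disjoint val A1 :|: val A2 & val B] =
            [disjoint val A1 & val B] && [disjoint val A2 & val B].
    by rewrite -!setI_eq0 setIUl setU_eq0.
  rewrite -!andbA; case: ifP => // _; rewrite mulr1n inversionsUl //.
  by rewrite !exprD extmulA_signl.
apply: eq_bigr => A1 _.
under [RHS]eq_bigr => D _ do rewrite !ffunE.
pose t (D : {set 'I_n}) (A2 : kset V k) (B : kset V l) : K :=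
    ((-1) ^+ inversions (val A1) D *
       (x A1 * ((-1) ^+ inversions (val A2) (val B) * (y A2 * z B)))) *+
     (([disjoint val A1 & D] && (val A1 :|: D == val S'))).
transitivity (\sum_(D : kset V (k + l)) \sum_(A2 : kset V k)
    \sum_(B : kset V l |
       [disjoint val A2 & val B] && (val A2 :|: val B == val D))
       t (val D) A2 B); last first.
  rewrite [RHS]big_mkcond /=; apply: eq_bigr => D _; rewrite /t.
  case: ifP => _; last by rewrite big1 // => A2 _; rewrite big1.
  rewrite !mulr_sumr; apply: eq_bigr => A2 _.
  by rewrite !mulr_sumr; apply: eq_bigr => B _.
rewrite exchange_big /=; apply: eq_bigr => A2 _.
rewrite [RHS](exchange_big_dep predT) //= [LHS]big_mkcond.
apply: eq_bigr => B _.
case dA: [disjoint val A2 & val B]; last by rewrite big_pred0_eq /dj3 dA !andbF.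
rewrite /= (big_kset1 (fun D => t D A2 B) (erefl _)); last first.
  move: dA; rewrite -leq_card_setU => /eqP->.
  by rewrite (eqP (valP A2)) (eqP (valP B)).
rewrite /t /dj3 dA /= /sg3 -eqS.
have -> : [disjoint val A1 & val A2 :|: val B] =
            [disjoint val A1 & val A2] && [disjoint val A1 & val B].
  by rewrite -!setI_eq0 setIUr setU_eq0.
rewrite setUA -!andbA; case: ifP => // _; rewrite mulr1n inversionsUr //.
by rewrite !exprD extmulA_signr.
Qed.

(** The coordinate of [y] at [B] is, up to sign, the top coordinate of the
product of the basis vector of index [~: B] with [y]. *)
Lemma extmul_nondeg j k (y : extpow V k) : (j + k)%N = n ->
  (forall x : extpow V j, extmul x y = 0) -> y = 0.
Proof.
move=> jk y0; apply/ffunP=> B; rewrite [RHS]ffunE.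
have cA : #|~: val B| == j.
  by rewrite cardsCs setCK card_ord (eqP (valP B)) -jk addnK.
have cT : #|[set: 'I_n]| == (j + k)%N by rewrite cardsT card_ord jk.
pose A : kset V j := Sub (~: val B) cA.
have /ffunP/(_ (Sub [set: 'I_n] cT)) := y0 [ffun S => (S == A)%:R].
rewrite !ffunE (bigD1 A) //= [X in _ + X]big1 ?addr0; last first.
  by move=> S nA; rewrite big1 // => C _; rewrite ffunE (negbTE nA) mul0r mulr0.
rewrite (big_pred1 B) => [|C]; last first.
  apply/andP/eqP => /= [[dBC /eqP/setP uBC]|->].
    apply/val_inj/setP => l; have := uBC l; rewrite !inE.
    have [lB // | nB _] := boolP (l \in val B).
    by rewrite (disjointFr dBC) // inE.
  by rewrite setUC setUCr disjoint_sym -setI_eq0 setICr.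
by rewrite ffunE eqxx mul1r => /eqP; rewrite mulf_eq0 signr_eq0 => /eqP.
Qed.

Lemma ext1_basis (i : 'I_n) (A : kset V 1) : ext1 e`_i A = (i \in val A)%:R.
Proof.
rewrite ffunE; under eq_bigr => l _ do
  rewrite coord_free ?(basis_free (vbasisP _)) //.
case iA: (i \in val A).
  rewrite (bigD1 i) //= eqxx big1 ?addr0 // => l /andP[_ /negbTE li].
  by rewrite eq_sym li.
by rewrite big1 // => l lA; case: eqP => // il; rewrite il lA in iA.
Qed.

Lemma wedge_basis (i j : 'I_n) : (i < j)%N ->
  wedge e`_i e`_j = [ffun S : kset V 2 => (val S == [set i; j])%:R].
Proof.
move=> ij; apply/ffunP=> S; rewrite !ffunE.
have mem1 (l : 'I_n) (A : kset V 1) : (l \in val A) = ([set l] == val A).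
  case/cards1P: (valP A) => a ->; rewrite inE.
  by apply/eqP/eqP => [->|/set1_inj].
transitivity (\sum_(A : kset V 1 | [set i] == val A)
    \sum_(B : kset V 1 | [set j] == val B)
    (if [disjoint val A & val B] && (val A :|: val B == val S)
     then (-1) ^+ inversions (val A) (val B) else 0) : K).
  rewrite [RHS]big_mkcond; apply: eq_bigr => A _.
  rewrite [LHS]big_mkcond; case: ifP => iA; last first.
    by apply: big1 => B _; rewrite ext1_basis mem1 iA mul0r mulr0 if_same.
  rewrite [RHS]big_mkcond; apply: eq_bigr => B _.
  rewrite !ext1_basis !mem1 iA mul1r.
  by case: ifP => _; case: ([set j] == val B); rewrite /= ?mulr0 ?mulr1.
pose t (A B : {set 'I_n}) : K :=
   if [disjoint A & B] && (A :|: B == val S) then (-1) ^+ inversions A B else 0.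
transitivity (\sum_(A : kset V 1 | [set i] == val A) t (val A) [set j]).
  apply: eq_bigr => A _.
  by rewrite (big_kset1 (t (val A)) (cards1 j) (erefl _)).
rewrite (big_kset1 (t^~ [set j]) (cards1 i) (erefl _)) /t.
have -> : inversions [set i] [set j] = 0%N.
  apply: eq_card0 => -[a b]; rewrite !inE /=.
  by case: eqP => //= ->; case: eqP => //= ->; rewrite ltnNge ltnW.
have -> : [disjoint [set i] & [set j]].
  by rewrite disjoints1 inE -val_eqE neq_ltn ij.
by rewrite /= expr0 eq_sym; case: eqP.
Qed.

Lemma kset2_pair : exists p : kset V 2 -> 'I_n * 'I_n,
  forall A, ((p A).1 < (p A).2)%N /\ val A = [set (p A).1; (p A).2].
Proof.
have pairP (A : kset V 2) :
    exists p : 'I_n * 'I_n, (p.1 < p.2)%N /\ val A = [set p.1; p.2].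
  have /cards2P[a [b [ab ->]]] := valP A.
  move: ab; rewrite -val_eqE neq_ltn => /orP[] ab; first by exists (a, b).
  by exists (b, a); rewrite setUC.
have [p pP] := fin_all_exists pairP; by exists p.
Qed.

Lemma extpow2_sum (x : extpow V 2) :
  exists p : kset V 2 -> V * V, x = \sum_A x A *: wedge (p A).1 (p A).2.
Proof.
have [p pP] := kset2_pair; exists (fun A => (e`_(p A).1, e`_(p A).2)).
apply/ffunP=> S; rewrite sum_ffunE (bigD1 S) //= [X in _ + X]big1 ?addr0.
  have [lt_p eqS] := pP S.
  by rewrite ffunE wedge_basis // ffunE -eqS eqxx [RHS]mulr1.
move=> A nA; have [lt_p eqA] := pP A; rewrite ffunE wedge_basis // ffunE -eqA.
by rewrite val_eqE eq_sym (negbTE nA) [LHS]mulr0.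
Qed.

Lemma eq_hom_wedge (W : vectType K) (f g : 'Hom(extpow V 2, W)) :
  (forall u v, f (wedge u v) = g (wedge u v)) -> f = g.
Proof.
move=> fg; apply/lfunP=> x; have [p ->] := extpow2_sum x.
by rewrite !linear_sum; apply: eq_bigr => A _; rewrite !linearZ /= fg.
Qed.

(** The universal property of the exterior square; the map is given by its
values on the products of basis vectors [e_i /\ e_j] with [i < j]. *)
Lemma wedge_universal (W : vectType K) (b : V -> V -> W) :
    (forall u, linear (b u)) -> (forall v, linear (b^~ v)) ->
    (forall u, b u u = 0) ->
  exists f : 'Hom(extpow V 2, W), forall u v, f (wedge u v) = b u v.
Proof.
move=> br bl b0; have [p pP] := kset2_pair.
pose f0 (x : extpow V 2) := \sum_A x A *: b e`_(p A).1 e`_(p A).2.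
have f0P : linear f0.
  move=> a x y; rewrite /f0 scaler_sumr -big_split; apply: eq_bigr => A _ /=.
  by rewrite !ffunE scalerA -scalerDl.
have bC := alternating_skew br bl b0.
exists (linfun f0).
have fe (i j : 'I_n) : (i < j)%N -> linfun f0 (wedge e`_i e`_j) = b e`_i e`_j.
  move=> ij; rewrite linfunE // wedge_basis // /f0.
  have cA : #|[set i; j]| == 2.
    by rewrite cards2 -val_eqE neq_ltn ij.
  rewrite (bigD1 (Sub [set i; j] cA)) //= big1 => [|A nA]; last first.
    by rewrite ffunE -[_ == _]/(A == Sub [set i; j] cA) (negbTE nA) scale0r.
  rewrite ffunE eqxx scale1r addr0.
  case: (pP (Sub [set i; j] cA)); case: (p _) => a c /= ac /setP eqA.
  have := eqA a; have := eqA c; have := eqA i; have := eqA j.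
  rewrite !inE !eqxx ?orbT /= => /esym/orP jP /esym/orP iP /orP cP /orP aP.
  case: aP => /eqP ai; case: cP => /eqP cj; subst => //.
  - by rewrite ltnn in ac.
  - by rewrite ltnNge ltnW in ac.
  by rewrite ltnn in ac.
have br' u : linear (fun v => linfun f0 (wedge u v)).
  by move=> a v w; rewrite wedge_linearr linearP.
have bl' v : linear (fun u => linfun f0 (wedge u v)).
  by move=> a u w; rewrite wedge_linearl linearP.
move=> u v; move: u; apply: eq_linear_basis => // i.
move: v; apply: eq_linear_basis => // j.
(* Beyond the basis, nth returns the default value 0. *)
have eF l : (n <= l)%N -> e`_l = 0.
  by move=> nl; rewrite nth_default ?size_tuple.
have b_0 w : b 0 w = 0.
  by rewrite -[LHS](linfunE (bl w)) linear0.
have w_0 w : linfun f0 (wedge 0 w) = 0.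
  by rewrite -[LHS](linfunE (bl' w)) linear0.
have [/eF->|i_n] := leqP n i; first by rewrite b_0 w_0.
have [/eF->|j_n] := leqP n j; first by rewrite bC wedgeC linearN /= b_0 w_0.
have [ij|ji|->] := ltngtP i j; last by rewrite wedgexx linear0 b0.
  exact: (fe (Ordinal i_n) (Ordinal j_n)).
by rewrite wedgeC linearN bC /= (fe (Ordinal j_n) (Ordinal i_n)).
Qed.

Lemma dim_extpow k : \dim {: extpow V k} = 'C(n, k).
Proof.
rewrite dimvf -[LHS]/(#|{: kset V k}| * 1)%N.
by rewrite muln1 card_sig -[in RHS](card_ord n) -card_draws cardsE.
Qed.

Lemma extmul0l j k (y : extpow V k) : extmul (0 : extpow V j) y = 0.
Proof. by rewrite -[LHS](linfunE (extmul_is_linearl y)) linear0. Qed.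

Lemma extmulBl j k (x x' : extpow V j) (y : extpow V k) :
  extmul (x - x') y = extmul x y - extmul x' y.
Proof.
rewrite -[LHS](linfunE (extmul_is_linearl y)) linearB /=.
by rewrite !(linfunE (extmul_is_linearl y)).
Qed.

Lemma wedge_linear u : linear (wedge u : V -> extpow V 2).
Proof. by move=> a v w; rewrite wedge_linearr. Qed.

Definition wedge4 (a b c d : V) : extpow V 4 := extmul (wedge a b) (wedge c d).

Lemma wedge4_linear1 b c d : linear (fun a => wedge4 a b c d).
Proof. by move=> k u v; rewrite /wedge4 wedge_linearl extmul_is_linearl. Qed.

Lemma wedge4_linear2 a c d : linear (fun b => wedge4 a b c d).
Proof. by move=> k u v; rewrite /wedge4 wedge_linearr extmul_is_linearl. Qed.

Lemma wedge4_linear3 a b d : linear (fun c => wedge4 a b c d).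
Proof. by move=> k u v; rewrite /wedge4 wedge_linearl linearP. Qed.

Lemma wedge4_linear4 a b c : linear (wedge4 a b c).
Proof. by move=> k u v; rewrite /wedge4 wedge_linearr linearP. Qed.

Lemma wedge4_alternating : alternating4 wedge4.
Proof.
split.
- split.
  + exact: wedge4_linear1.
  + exact: wedge4_linear2.
  + exact: wedge4_linear3.
  exact: wedge4_linear4.
- by move=> a c d; rewrite /wedge4 wedgexx extmul0l.
- move=> a b d.
  (* a /\ b /\ b /\ d is reassociated so that the factor b /\ b appears. *)
  transitivity (extmul (ext1 a) (extmul (ext1 b) (wedge b d)) : extpow V 4).
    apply/ffunP => S.
    exact: (@extmulA 1 1 2 (ext1 a) (ext1 b) (wedge b d) S S (erefl _)).
  suff -> : extmul (ext1 b) (wedge b d) = 0 by rewrite linear0.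
  transitivity (extmul (wedge b b) (ext1 d) : extpow V 3).
    apply/ffunP => S.
    by rewrite -(@extmulA 1 1 1 (ext1 b) (ext1 b) (ext1 d) S S (erefl _)).
  by rewrite wedgexx extmul0l.
by move=> a b c; rewrite /wedge4 wedgexx linear0.
Qed.

Lemma wedge4_swap a b c d : wedge4 a b c d = wedge4 c d a b.
Proof.
have altW := wedge4_alternating.
rewrite (alt4C23 altW) (alt4C12 altW) (alt4C34 altW) (alt4C23 altW).
by rewrite !opprK.
Qed.

Lemma extmul2C (x y : extpow V 2) : extmul x y = extmul y x.
Proof.
have [p ->] := extpow2_sum x; have [q ->] := extpow2_sum y.
have sumE (I : finType) (c : I -> K) (t : I -> extpow V 2) (z : extpow V 2) :
    extmul (\sum_i c i *: t i) z = \sum_i c i *: extmul (t i) z.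
  have lz := extmul_is_linearl (j := 2) z.
  rewrite -[LHS](linfunE lz) linear_sum.
  by apply: eq_bigr => i _; rewrite linearZ /= (linfunE lz).
rewrite !sumE.
under eq_bigr => A _ do rewrite linear_sum scaler_sumr.
rewrite exchange_big; apply: eq_bigr => B _.
rewrite linear_sum scaler_sumr; apply: eq_bigr => A _.
by rewrite !linearZ /= !scalerA mulrC -[in LHS]/(wedge4 _ _ _ _) wedge4_swap.
Qed.

(** If a vector is orthogonal to [X], then so is its component in [L] along [Y];
as [L] is totally isotropic, this component is orthogonal to [X + L], hence
zero. *)
Lemma polar_complement (X Y L : {vspace extpow V 2}) : \dim {:V} = 4%N ->
    (forall x y, x \in X -> y \in Y -> extmul x y = 0) ->
    (forall x y, x \in L -> y \in L -> extmul x y = 0) ->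
    (X + L = fullv)%VS -> (Y + L = fullv)%VS -> polar X = Y.
Proof.
move=> dV XY LL XL YL; apply/eqP; rewrite eqEsubv; apply/andP; split.
  apply/subvP => z /memv_polarP Xz.
  have : z \in (Y + L)%VS by rewrite YL memvf.
  case/memv_addP => y Yy [l Ll def_z].
  suff l0 : l = 0 by rewrite def_z l0 addr0.
  apply: (@extmul_nondeg 2 2); first by rewrite dV.
  move=> x; have : x \in (X + L)%VS by rewrite XL memvf.
  case/memv_addP => x1 Xx1 [l1 Ll1 ->].
  rewrite -[x1]scale1r extmul_is_linearl (LL _ _ Ll1 Ll) addr0 scale1r.
  have -> : l = z - y by rewrite def_z addrC addKr.
  by rewrite linearB /= Xz // XY // subr0.
by apply/subvP => y Yy; apply/memv_polarP => x Xx; apply: XY.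
Qed.

End ExteriorAlgebra.

(** * The kernel of a map from the exterior square to the quotient *)

Section Images.
Variables (K : fieldType) (V W : vectType K).

Lemma eq_limg_lker (f : 'Hom(V, W)) (X Y : {vspace V}) :
  (lker f + X = lker f + Y)%VS <-> (f @: X = f @: Y)%VS.
Proof.
have lker_img Z : (f @: (lker f + Z) = f @: Z)%VS.
  by rewrite limgD (eqP (_ : f @: lker f == 0)%VS) ?add0v // -lkerE subvv.
split=> [eqXY|eqXY]; first by rewrite -lker_img eqXY lker_img.
suff sub (A B : {vspace V}) : (f @: A <= f @: B -> A <= lker f + B)%VS.
  by apply/eqP; rewrite eqEsubv !subv_add !addvSl !sub ?eqXY.
move=> /subvP fAB; apply/subvP => a Aa.
have /memv_imgP[b Bb fab] := fAB _ (memv_img f Aa).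
rewrite -(subrK b a) memv_add //.
by rewrite memv_ker linearB /= fab subrr.
Qed.

Lemma line_basis (M : {vspace V}) u : \dim M = 2%N -> u \in M -> u != 0 ->
  exists v, basis_of M [:: u; v].
Proof.
move=> dM Mu u0; have /subvPn[v Mv uv] : ~~ (M <= <[u]>)%VS.
  by apply/negP => /dimvS; rewrite dM dim_vline u0.
exists v; rewrite (perm_basis (Y := [:: v; u])) ?(perm_catC [:: u] [:: v]) //.
rewrite basisEfree free_cons span_seq1 uv seq1_free u0 dM leqnn andbT.
by rewrite andbT; apply/span_subvP => w; rewrite !inE => /orP[] /eqP->.
Qed.

Lemma exists_nz (M : {vspace V}) : (0 < \dim M)%N ->
  exists2 u, u \in M & u != 0.
Proof.
by rewrite lt0n dimv_eq0 => M0; exists (vpick M); rewrite ?memv_pick ?vpick0.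
Qed.

End Images.

Section PlaneOfMap.
Variables (F : fieldType) (H : falgType F).

Local Notation pr := (quotv_proj (1%VS : {vspace H})).

Lemma lker_proj : lker (linfun pr) = 1%VS.
Proof. by apply/vspaceP => h; rewrite memv_ker lfunE /= quotv_proj_eq0. Qed.

Lemma proj_surj (x : quotv (1%VS : {vspace H})) : exists h, x = pr h.
Proof. by exists (repr x); rewrite /quotv_proj generic_quotient.reprK. Qed.

(** The plane filled by the Pluecker points of the lines through the point 1. *)
Definition lines1 : {vspace extpow H 2} := limg (linfun (wedge (1 : H))).

Lemma lines1E h : wedge 1 h \in lines1.
Proof. by rewrite -(linfunE (wedge_linear 1)) memv_img ?memvf. Qed.

Lemma wedge1_scalar (h : H) : h \in 1%VS -> wedge 1 h = 0.
Proof.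
move=> /vlineP[k ->].
by rewrite -(linfunE (wedge_linear 1)) linearZ /= (linfunE (wedge_linear 1))
  wedgexx scaler0.
Qed.

Lemma lines1_isotropic (x y : extpow H 2) :
  x \in lines1 -> y \in lines1 -> extmul x y = 0.
Proof.
move=> /memv_imgP[g _ ->] /memv_imgP[h _ ->].
rewrite !(linfunE (wedge_linear 1)) -/(wedge4 _ _ _ _).
rewrite (alt4C23 (wedge4_alternating H)).
by case: (wedge4_alternating H) => _ -> _ _; rewrite oppr0.
Qed.

(** Below, [q u v] is [bar u * v] or [v * bar u]. *)
Variables (q : H -> 'End(H)) (f : 'Hom(extpow H 2, quotv (1%VS : {vspace H}))).
Hypothesis dimH : \dim {:H} = 4%N.
Hypothesis q_diag : forall u, q u u \in 1%VS.
Hypothesis q_inj : forall u, u != 0 -> lker (q u) == 0%VS.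
Hypothesis q_1 : forall h, q 1 h = h.
Hypothesis fE : forall u v, f (wedge u v) = quotv_proj 1%VS (q u v).

(** In a basis [u, v] of [M] both sides are spanned by the class of [q u v], as
[q u u] is a scalar. *)
Lemma pluecker_img (M : {vspace H}) u : \dim M = 2%N -> u \in M -> u != 0 ->
  (f @: pluecker M = linfun pr @: (q u @: M))%VS.
Proof.
move=> dM Mu u0; have [v bM] := line_basis dM Mu u0.
rewrite (plueckerE bM) limg_line fE -(span_basis bM) !limg_span /=.
have -> : linfun pr (q u u) = 0 by apply/eqP; rewrite -memv_ker lker_proj.
by rewrite lfunE span_cons /= span_seq1 addvC addv0.
Qed.

Lemma sub1_img (M : {vspace H}) u : u \in M -> u != 0 -> (1 <= q u @: M)%VS.
Proof.
move=> Mu u0; have quM := memv_img (q u) Mu.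
have /vlineP[k quE] := q_diag u.
suff k0 : k != 0 by rewrite -memvE -(scalerK k0 (1 : H)) memvZ // -quE.
apply/eqP => k0; move: quE; rewrite k0 scale0r => /eqP.
by rewrite -memv_ker (eqP (q_inj u0)) memv0 (negbTE u0).
Qed.

(** Both [q u @: M] and [q w @: N] contain the scalars, so that they can be
compared modulo the scalars, where they are the images under [f]. *)
Lemma clifford_parallelE (M N : {vspace H}) u w :
    \dim M = 2%N -> \dim N = 2%N ->
    u \in M -> u != 0 -> w \in N -> w != 0 ->
  clifford_parallel (lker f) M N <-> (q u @: M = q w @: N)%VS.
Proof.
move=> dM dN Mu u0 Nw w0; rewrite /clifford_parallel.
apply: (iff_trans (eq_limg_lker _ _ _)).
rewrite (pluecker_img dM Mu u0) (pluecker_img dN Nw w0).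
apply: (iff_trans (iff_sym (eq_limg_lker _ _ _))); rewrite lker_proj.
by rewrite !(addv_idPr _) ?sub1_img.
Qed.

Lemma lker_disjoint_quadric P : klein_quadric P -> ~ (P <= lker f)%VS.
Proof.
move=> [M dM ->]; have [|u Mu u0] := @exists_nz _ _ M; first by rewrite dM.
rewrite lkerE (pluecker_img dM Mu u0) -lkerE lker_proj => /dimvS.
by rewrite limg_dim_eq ?(eqP (q_inj u0)) ?capv0 // dM dimv1.
Qed.

Lemma dim_lker : \dim (lker f) = 3%N.
Proof.
have fT : limg f = fullv.
  apply/eqP; rewrite eqEsubv subvf; apply/subvP => x _.
  have [h ->] := proj_surj x.
  by rewrite -[h]q_1 -fE memv_img ?memvf.
have := limg_ker_dim f fullv; rewrite fT capfv dim_extpow dimH.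
have -> : \dim {: quotv (1%VS : {vspace H})} = \dim (1%VS : {vspace H})^C.
  by rewrite dimvf.
(* The exterior square has dimension 'C(4, 2) = 6, the quotient 4 - 1. *)
by rewrite dimv_compl dimv1 dimH -[RHS]/(3 + 3)%N => /addIn.
Qed.

Lemma lker_compl : (lker f + lines1 = fullv)%VS.
Proof.
apply/eqP; rewrite eqEsubv subvf; apply/subvP => x _.
have [h fx] := proj_surj (f x).
rewrite -(subrK (wedge 1 h) x) memv_add ?lines1E // memv_ker.
by rewrite linearB /= fE q_1 fx subrr.
Qed.

(** The vectors [u /\ v - 1 /\ q u v] span the kernel of [f]: if [y] is a
combination of products [u /\ v], then the same combination [h] of the [q u v]
is a scalar when [f y = 0], and [y] is equal to [y - 1 /\ h]. *)
Lemma lker_sub (X : {vspace extpow H 2}) :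
  (forall u v, wedge u v - wedge 1 (q u v) \in X) -> (lker f <= X)%VS.
Proof.
move=> dX; apply/subvP => y fy; have [p yE] := extpow2_sum y.
pose h := \sum_A y A *: q (p A).1 (p A).2.
have hF : h \in 1%VS.
  rewrite -quotv_proj_eq0 linear_sum /=.
  under eq_bigr => A _ do rewrite linearZ /= -fE -linearZ.
  by rewrite -linear_sum -yE -memv_ker.
have : wedge 1 h = 0 by apply: wedge1_scalar.
rewrite -(linfunE (wedge_linear 1)) linear_sum => h0.
rewrite -[y]subr0 -[X in _ - X]h0 {1}yE -sumrB.
apply: rpred_sum => A _.
by rewrite linearZ /= (linfunE (wedge_linear 1)) -scalerBr rpredZ // dX.
Qed.

End PlaneOfMap.

(** * The conjugation *)

Lemma canonical_conjP (F : fieldType) (H : falgType F) (bar : 'End(H)) :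
  canonical_conj bar ->
  [/\ skew_field H, \dim {:H} = 4%N, lker bar == 0%VS,
      {morph bar : g h / g * h >-> h * g} &
      [/\ forall h, bar h * h \in 1%VS, forall h, bar h * h = h * bar h &
          forall h, h + bar h \in 1%VS]].
Proof.
case=> [[[skewH _ dimH] [bij_bar barM barP]] | [[skewH mulHC dimH sqF] ->]].
  split=> //; first by apply/lker0P/bij_inj.
  by split=> h; have [hC hN hT _] := barP h; rewrite ?hC.
split=> //.
- by apply/lker0P => x y; rewrite !id_lfunE.
- by move=> g h; rewrite !id_lfunE mulHC.
split=> h; rewrite !id_lfunE ?[h * h]sqF //; first exact: sqF.
rewrite -(rpredDr _ (rpredD (sqF h) (memv_line 1))) addrCA addrA.
by rewrite -sqrrD1 sqF.
Qed.

Lemma limg_amull (F : fieldType) (H : falgType F) (U : {vspace H}) c :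
  (amull c @: U = <[c]> * U)%VS.
Proof.
apply/eqP; rewrite eqEsubv; apply/andP; split.
  apply/subvP => _ /memv_imgP[u Uu ->]; rewrite lfunE.
  by rewrite memv_mul ?memv_line.
apply/prodvP => _ u /vlineP[a ->] Uu.
by rewrite -scalerAl memvZ // -[c * u](_ : amull c u = _) ?memv_img // lfunE.
Qed.

Lemma vline_scale (F : fieldType) (V : vectType F) k (v : V) :
  k != 0 -> (<[k *: v]> = <[v]>)%VS.
Proof.
move=> k0; apply/eqP; rewrite eqEsubv -!memvE memvZ ?memv_line //=.
by rewrite -{1}[v](scalerK k0) memvZ // memv_line.
Qed.

Section Conj.

Variables (F : fieldType) (H : falgType F) (bar : 'End(H)).
Hypothesis skewH : skew_field H.
Hypothesis dimH : \dim {:H} = 4%N.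
Hypothesis bar_inj : lker bar == 0%VS.
Hypothesis barM : {morph bar : g h / g * h >-> h * g}.
Hypothesis bar_norm : forall h, bar h * h \in 1%VS.
Hypothesis normC : forall h, bar h * h = h * bar h.
Hypothesis bar_tr : forall h, h + bar h \in 1%VS.

Lemma bar_neq0 h : h != 0 -> bar h != 0.
Proof. by move=> h0; rewrite -memv_ker (eqP bar_inj) memv0. Qed.

Lemma bar1 : bar 1 = 1.
Proof.
have u1 := skewH (bar_neq0 (oner_neq0 H)).
by apply: (mulrI u1); rewrite -barM !mulr1.
Qed.

Lemma bar_norm_neq0 c : c != 0 -> exists2 n : F, n != 0 & bar c * c = n *: 1.
Proof.
move=> c0; have /vlineP[n nE] := bar_norm c; exists n => //.
apply/eqP => n0; move: nE; rewrite n0 scale0r => bcc.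
have : bar c * c \is a GRing.unit by rewrite unitrMl skewH ?bar_neq0.
by rewrite bcc unitr0.
Qed.

Lemma bar_polar g h : g * bar h + h * bar g \in 1%VS.
Proof.
have norm' x : x * bar x \in 1%VS by rewrite -normC.
rewrite -(rpredDr _ (rpredD (norm' g) (norm' h))) addrACA.
by rewrite [g * bar h + _]addrC -!mulrDr -mulrDl -linearD norm'.
Qed.

(** By [lker_sub], the values of [dl] span the kernel of kappa, and those of
[dr] the kernel of kappa'. *)
Definition dl (u v : H) : extpow H 2 := wedge u v - wedge 1 (bar u * v).
Definition dr (u v : H) : extpow H 2 := wedge u v - wedge 1 (v * bar u).

(** * The trace identity *)

Section Subfield.

Variable x : H.
Local Notation K := (1 + <[x]>)%VS.
(* K is F(x), and T c d depends only on the classes of c and d modulo K. *)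
Local Notation T c d := (wedge4 1 x c d).

Lemma memK y : reflect (exists a b, y = a *: 1 + b *: x) (y \in K).
Proof.
apply: (iffP memv_addP) => [[_ /vlineP[a ->] [_ /vlineP[b ->] ->]]|[a [b ->]]].
  by exists a, b.
exists (a *: 1); rewrite ?memvZ ?memv_line //.
by exists (b *: x); rewrite ?memvZ ?memv_line.
Qed.

Lemma bar_quadratic :
  exists t n : F, bar x = t *: 1 - x /\ x * x = t *: x - n *: 1.
Proof.
have /vlineP[t tE] := bar_tr x; have /vlineP[n nE] := bar_norm x.
exists t, n; have bx : bar x = t *: 1 - x by rewrite -tE addrC addKr.
split=> //; rewrite -nE bx mulrBl -scalerAl mul1r opprB addrC.
by rewrite subrK.
Qed.

Lemma K1 : 1 \in K.
Proof. by apply/memK; exists 1, 0; rewrite scale1r scale0r addr0. Qed.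

Lemma Kx : x \in K.
Proof. by apply/memK; exists 0, 1; rewrite scale1r scale0r add0r. Qed.

Lemma K_xmul k : k \in K -> x * k \in K.
Proof.
have [t [n [_ xx]]] := bar_quadratic.
move=> /memK[a [b ->]]; rewrite mulrDr -!scalerAr mulr1 xx.
by rewrite rpredD ?rpredZ ?rpredB ?rpredZ ?K1 ?Kx.
Qed.

Lemma K_mul k l : k \in K -> l \in K -> k * l \in K.
Proof.
move=> /memK[a [b ->]] Kl; rewrite mulrDl -!scalerAl mul1r.
by rewrite rpredD // rpredZ // K_xmul.
Qed.

Lemma K_bar k : k \in K -> bar k \in K.
Proof.
have [t [n [bx _]]] := bar_quadratic.
move=> /memK[a [b ->]]; rewrite linearD !linearZ /= bar1 bx.
by rewrite rpredD ?rpredZ ?rpredB ?rpredZ ?K1 ?Kx.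
Qed.

Lemma TK3 k d : k \in K -> T k d = 0.
Proof.
have [[_ _ l3 _] h12 h23 h34] := wedge4_alternating H.
move=> /memK[a [b ->]]; rewrite -[LHS](linfunE (l3 _ _ _)).
rewrite linearD !linearZ /= !(linfunE (l3 _ _ _)) h23 scaler0 addr0.
by rewrite (alt4C23 (wedge4_alternating H)) h12 oppr0 scaler0.
Qed.

Lemma TK4 c k : k \in K -> T c k = 0.
Proof. by move=> Kk; rewrite (alt4C34 (wedge4_alternating H)) TK3 ?oppr0. Qed.

(** [K] and [K * v] are two-dimensional, and they are disjoint because [K] is
closed under division. *)
Lemma K_full v : x \notin 1%VS -> v \notin K -> (K + K * <[v]> = fullv)%VS.
Proof.
move=> nx nv; apply/eqP; rewrite eqEdim subvf dimH.
have dK : \dim K = 2%N.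
  rewrite dimv_disjoint_sum ?dimv1 ?dim_vline.
    by case: eqP nx => // ->; rewrite mem0v.
  apply/eqP; rewrite -subv0; apply/subvP => y; rewrite memv_cap memv0.
  case/andP => y1 /vlineP[b yE]; rewrite yE scaler_eq0.
  apply: contraNT nx; rewrite negb_or => /andP[b0 _].
  by rewrite -(scalerK b0 x) -yE memvZ.
have v0 : v != 0 by apply: contraNneq nv => ->; rewrite mem0v.
rewrite dimv_disjoint_sum ?(dim_cosetv_unit _ (skewH v0)) ?dK //.
apply/eqP; rewrite -subv0; apply/subvP => y; rewrite memv_cap memv0.
case/andP => Ky /memv_cosetP[k Kk yE]; apply: contraNT nv => y0.
have k0 : k != 0 by apply: contraNneq y0 => k0; rewrite yE k0 mul0r.
have [n n0 nE] := bar_norm_neq0 k0.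
rewrite -(scalerK n0 v) memvZ // -mulr_algl -nE -mulrA -yE.
by rewrite K_mul // K_bar.
Qed.

(** Since [bar x = t - x] for a scalar [t], and [w * bar x = x * w] modulo [K],
this is the identity [x v /\ w + v /\ x w = t (v /\ w)] in the exterior square
of [H / K].  If [v] is not in [K], then [v] spans [H / K] over [K], so it is
enough to take [w = v] and [w = x v], where [x^2 = t x - n] applies. *)
Lemma wedge_trace v w : T (bar x * v) w = T v (w * bar x).
Proof.
have [t [n [bx xx]]] := bar_quadratic.
have [[l1 l2 l3 l4] h12 h23 h34] := wedge4_alternating H.
have [xF|nx] := boolP (x \in 1%VS).
  have T0 c d : T c d = 0.
    by rewrite /wedge4 wedge1_scalar // extmul0l.
  by rewrite !T0.
have l3E c d : T c d = linfun (fun c => T c d) c by rewrite linfunE.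
have l4E c d : T c d = linfun (fun d => T c d) d by rewrite linfunE.
have barxv c d : T (bar x * c) d = t *: T c d - T (x * c) d.
  rewrite bx mulrBl -scalerAl mul1r l3E linearB linearZ /=.
  by rewrite !(linfunE (l3 _ _ _)).
have wbarx c d : T c (d * bar x) = T c (x * d).
  have [/vlineP[m mE]] : d * bar x + x * bar d \in 1%VS by apply: bar_polar.
  have /vlineP[s sE] := bar_tr d.
  have -> : d * bar x = (m *: 1 - s *: x) + x * d.
    rewrite -mE; have -> : s *: x = x * (d + bar d).
      by rewrite sE -scalerAr mulr1.
    by rewrite mulrDr [x * d + _]addrC opprD addrA addrK subrK.
  rewrite l4E linearD /= -!l4E TK4 ?add0r //.
  by rewrite rpredB // rpredZ ?K1 ?Kx.
rewrite barxv wbarx.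
have [Kv|nv] := boolP (v \in K).
  by rewrite !TK3 ?K_xmul // scaler0 subr0.
pose g := t *: linfun (fun d => T v d) - linfun (fun d => T (x * v) d)
          - (linfun (fun d => T v d) \o amull x)%VF.
have gE d : g d = t *: T v d - T (x * v) d - T v (x * d).
  by rewrite !lfun_simp /= !(linfunE (l4 _ _ _)).
suff : w \in lker g by rewrite memv_ker gE subr_eq0 => /eqP.
apply: subvP (memvf w); rewrite -(K_full nx nv) subv_add; apply/andP; split.
  apply/subvP => k Kk; rewrite memv_ker gE !TK4 ?K_xmul //.
  by rewrite scaler0 !subr0.
have gv : g v = 0.
  by rewrite gE !h34 scaler0 sub0r (alt4C34 (wedge4_alternating H)) opprK subrr.
have gxv : g (x * v) = 0.
  rewrite gE h34 subr0 mulrA xx mulrBl -!scalerAl mul1r.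
  rewrite [T v (_ - _)]l4E linearB !linearZ /= -!l4E h34.
  by rewrite oppr0 scaler0 addr0 subrr.
apply/subvP => _ /memv_cosetP[k /memK[a [b ->]] ->].
rewrite memv_ker mulrDl -!scalerAl mul1r linearD !linearZ /= gv gxv.
by rewrite !scaler0 addr0.
Qed.

(** In the expansion only the two mixed terms survive, and they cancel by
[wedge_trace]. *)
Lemma dl_dr_common v w : extmul (dl x v) (dr x w) = 0.
Proof.
have [[l1 l2 l3 l4] h12 h23 h34] := wedge4_alternating H.
have C12 := alt4C12 (wedge4_alternating H).
have C23 := alt4C23 (wedge4_alternating H).
rewrite /dl /dr extmulBl !linearB /= -!/(wedge4 _ _ _ _).
rewrite [wedge4 x v x w]C23 h12 oppr0 sub0r.
rewrite [wedge4 1 _ 1 _]C23 h12 !oppr0 addr0.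
rewrite [wedge4 x v 1 _]C23 [wedge4 x 1 _ _]C12 [wedge4 1 _ x w]C23.
by rewrite !opprK wedge_trace addNr.
Qed.

End Subfield.

(** * Polarity of the two planes *)

Lemma dl_linear2 u : linear (dl u).
Proof.
move=> a v w; rewrite /dl mulrDr -scalerAr !wedge_linearr.
by rewrite scalerBr opprD addrACA.
Qed.

Lemma dl_linear1 v : linear (dl^~ v).
Proof.
move=> a u w; rewrite /dl linearP mulrDl -scalerAl wedge_linearr wedge_linearl.
by rewrite scalerBr opprD addrACA.
Qed.

Lemma dr_linear2 u : linear (dr u).
Proof.
move=> a v w; rewrite /dr mulrDl -scalerAl !wedge_linearr.
by rewrite scalerBr opprD addrACA.
Qed.

Lemma dr_linear1 v : linear (dr^~ v).
Proof.
move=> a u w; rewrite /dr linearP mulrDr -scalerAr wedge_linearr wedge_linearl.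
by rewrite scalerBr opprD addrACA.
Qed.

Lemma dl_alt u : dl u u = 0.
Proof. by rewrite /dl wedgexx wedge1_scalar ?subr0 // bar_norm. Qed.

Lemma dr_alt u : dr u u = 0.
Proof. by rewrite /dr wedgexx wedge1_scalar ?subr0 // -normC bar_norm. Qed.

Lemma dl_dr0 u v x y : extmul (dl u v) (dr x y) = 0.
Proof.
apply: (@alt4_vanish _ _ _ (fun a b c d => extmul (dl a b) (dr c d)) _ 1).
- have L1 b c d : linear (fun a => extmul (dl a b) (dr c d)).
    by move=> k s t; rewrite dl_linear1 extmul_is_linearl.
  have L2 a c d : linear (fun b => extmul (dl a b) (dr c d)).
    by move=> k s t; rewrite dl_linear2 extmul_is_linearl.
  have A12 a c d : extmul (dl a a) (dr c d) = 0 by rewrite dl_alt extmul0l.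
  have S12 a b c d : extmul (dl a b) (dr c d) = - extmul (dl b a) (dr c d).
    exact: (alternating_skew (b := fun a b => extmul (dl a b) (dr c d))).
  split=> //.
  + split=> // [a b d|a b c] k s t; first by rewrite dr_linear1 linearP.
    by rewrite dr_linear2 linearP.
  + by move=> a b d; rewrite S12 dl_dr_common oppr0.
  by move=> a b c; rewrite dr_alt linear0.
- by rewrite dimH.
- exact: oner_neq0.
by move=> b c d; rewrite /dl bar1 mul1r subrr extmul0l.
Qed.

Variables f f' : 'Hom(extpow H 2, quotv (1%VS : {vspace H})).
Hypothesis fE : forall u v, f (wedge u v) = quotv_proj 1%VS (bar u * v).
Hypothesis fE' : forall u v, f' (wedge u v) = quotv_proj 1%VS (v * bar u).

Let ql u := amull (bar u).
Let qr u := amulr (bar u).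

Lemma qlE u v : ql u v = bar u * v. Proof. by rewrite /ql lfunE. Qed.
Lemma qrE u v : qr u v = v * bar u. Proof. by rewrite /qr lfunE. Qed.

Lemma ql_diag u : ql u u \in 1%VS. Proof. by rewrite qlE. Qed.
Lemma qr_diag u : qr u u \in 1%VS. Proof. by rewrite qrE -normC. Qed.
Lemma ql_inj u : u != 0 -> lker (ql u) == 0%VS.
Proof. by move=> u0; apply/lker0_amull/skewH/bar_neq0. Qed.
Lemma qr_inj u : u != 0 -> lker (qr u) == 0%VS.
Proof. by move=> u0; apply/lker0_amulr/skewH/bar_neq0. Qed.
Lemma ql1 h : ql 1 h = h. Proof. by rewrite qlE bar1 mul1r. Qed.
Lemma qr1 h : qr 1 h = h. Proof. by rewrite qrE bar1 mulr1. Qed.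
Lemma fql u v : f (wedge u v) = quotv_proj 1%VS (ql u v).
Proof. by rewrite qlE. Qed.
Lemma fqr u v : f' (wedge u v) = quotv_proj 1%VS (qr u v).
Proof. by rewrite qrE. Qed.

Lemma lkers_orth x y : x \in lker f -> y \in lker f' -> extmul x y = 0.
Proof.
move=> fx fy.
suff /subvP/(_ x fx) : (lker f <= lker (linfun (fun x => extmul x y)))%VS.
  by rewrite memv_ker (linfunE (extmul_is_linearl y)) => /eqP.
apply: (lker_sub fql) => u v.
rewrite memv_ker (linfunE (extmul_is_linearl y)).
set d := wedge u v - _.
suff /subvP/(_ y fy) : (lker f' <= lker (linfun (extmul d)))%VS.
  by rewrite memv_ker lfunE.
apply: (lker_sub fqr) => s t; rewrite memv_ker lfunE /= /d qlE qrE.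
by apply/eqP/dl_dr0.
Qed.

Lemma lkers_polar : lker f' = polar (lker f) /\ lker f = polar (lker f').
Proof.
have XL := lker_compl ql1 fql; have YL := lker_compl qr1 fqr.
split; apply/esym.
  exact: (polar_complement dimH lkers_orth (@lines1_isotropic _ H) XL YL).
apply: (polar_complement dimH _ (@lines1_isotropic _ H) YL XL) => x y fx fy.
by rewrite extmul2C lkers_orth.
Qed.

(** * The parallelisms *)

Lemma left_parallelP (M N : {vspace H}) : \dim M = 2%N -> \dim N = 2%N ->
  left_parallel M N <-> clifford_parallel (lker f) M N.
Proof.
move=> dM dN; have [|u Mu u0] := @exists_nz _ _ M; first by rewrite dM.
have E := clifford_parallelE ql_diag ql_inj fql dM dN Mu u0.
split=> [[c c0 MN] | MN].
  have uc := skewH c0; have Ncu : c * u \in N.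
    by rewrite -MN limg_amull memv_mul ?memv_line.
  have cu0 : c * u != 0 by rewrite mulrI_eq0 //; apply: mulrI.
  apply/(E _ Ncu cu0); rewrite /ql !limg_amull -MN limg_amull prodvA prodv_line.
  (* The two sides differ by the scalar factor bar c * c. *)
  have [n n0 nE] := bar_norm_neq0 c0.
  by rewrite barM -mulrA nE -scalerAr mulr1 vline_scale.
have [|w Nw w0] := @exists_nz _ _ N; first by rewrite dN.
move/(E _ Nw w0): MN; rewrite /ql !limg_amull => MN.
have uw := skewH (bar_neq0 w0); have uu := skewH (bar_neq0 u0).
exists ((bar w)^-1 * bar u).
  by apply: contraTneq (_ : (bar w)^-1 * bar u \is a GRing.unit) => [->|];
    rewrite ?unitr0 ?unitrMl ?unitrV.
by rewrite limg_amull -prodv_line -prodvA MN prodvA prodv_line mulVr // prod1v.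
Qed.

Lemma right_parallelP (M N : {vspace H}) : \dim M = 2%N -> \dim N = 2%N ->
  right_parallel M N <-> clifford_parallel (lker f') M N.
Proof.
move=> dM dN; have [|u Mu u0] := @exists_nz _ _ M; first by rewrite dM.
have E := clifford_parallelE qr_diag qr_inj fqr dM dN Mu u0.
split=> [[c c0 MN] | MN].
  have uc := skewH c0; have Nuc : u * c \in N.
    by rewrite -MN limg_amulr memv_mul ?memv_line.
  have uc0 : u * c != 0 by rewrite mulIr_eq0 //; apply: mulIr.
  apply/(E _ Nuc uc0).
  rewrite /qr !limg_amulr -MN limg_amulr -prodvA prodv_line.
  (* The two sides differ by the scalar factor bar c * c. *)
  have [n n0 nE] := bar_norm_neq0 c0.
  by rewrite barM mulrA -normC nE -scalerAl mul1r vline_scale.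
have [|w Nw w0] := @exists_nz _ _ N; first by rewrite dN.
move/(E _ Nw w0): MN; rewrite /qr !limg_amulr => MN.
have uw := skewH (bar_neq0 w0); have uu := skewH (bar_neq0 u0).
exists (bar u * (bar w)^-1).
  by apply: contraTneq (_ : bar u * (bar w)^-1 \is a GRing.unit) => [->|];
    rewrite ?unitr0 ?unitrMl ?unitrV.
by rewrite limg_amulr -prodv_line prodvA MN -prodvA prodv_line divrr // prodv1.
Qed.

Lemma clifford_planes :
  [/\ [/\ \dim (lker f) = 3%N,
          forall P, klein_quadric P -> ~ (P <= lker f)%VS &
          forall M N : {vspace H}, \dim M = 2%N -> \dim N = 2%N ->
            (left_parallel M N <-> clifford_parallel (lker f) M N)],
      [/\ \dim (lker f') = 3%N,
          forall P, klein_quadric P -> ~ (P <= lker f')%VS &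
          forall M N : {vspace H}, \dim M = 2%N -> \dim N = 2%N ->
            (right_parallel M N <-> clifford_parallel (lker f') M N)] &
      lker f' = polar (lker f) /\ lker f = polar (lker f')].
Proof.
split; last exact: lkers_polar.
  split; first exact: (dim_lker dimH ql1 fql).
    exact: (lker_disjoint_quadric ql_diag ql_inj fql).
  exact: left_parallelP.
split; first exact: (dim_lker dimH qr1 fqr).
  exact: (lker_disjoint_quadric qr_diag qr_inj fqr).
exact: right_parallelP.
Qed.

End Conj.

Theorem theorem5p1 (F : fieldType) (H : falgType F) (bar : 'End(H))
    (bar_conj : canonical_conj bar) :
  exists kappa kappa' : 'Hom(extpow H 2, quotv (1%VS : {vspace H})),
    [/\ unique (fun f : 'Hom(extpow H 2, quotv (1%VS : {vspace H})) =>
           forall g h : H, f (wedge g h) = quotv_proj 1%VS (bar g * h)) kappa,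
        unique (fun f : 'Hom(extpow H 2, quotv (1%VS : {vspace H})) =>
           forall g h : H, f (wedge g h) = quotv_proj 1%VS (g * bar h)) kappa' &
        let C := lker kappa in
        let C' := lker kappa' in
        [/\ [/\ \dim C = 3%N,
                forall P, klein_quadric P -> ~ (P <= C)%VS &
                forall M N : {vspace H}, \dim M = 2%N -> \dim N = 2%N ->
                  (left_parallel M N <-> clifford_parallel C M N)],
            [/\ \dim C' = 3%N,
                forall P, klein_quadric P -> ~ (P <= C')%VS &
                forall M N : {vspace H}, \dim M = 2%N -> \dim N = 2%N ->
                  (right_parallel M N <-> clifford_parallel C' M N)] &
            C' = polar C /\ C = polar C']].
Proof.
have [skewH dimH bar_inj barM [bar_norm normC bar_tr]] :=
  canonical_conjP bar_conj.
have br u : linear (fun v => quotv_proj (1%VS : {vspace H}) (bar u * v)).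
  by move=> a v w; rewrite mulrDr -scalerAr linearP.
have bl v : linear (fun u => quotv_proj (1%VS : {vspace H}) (bar u * v)).
  by move=> a u w; rewrite linearP mulrDl -scalerAl linearP.
have b0 u : quotv_proj (1%VS : {vspace H}) (bar u * u) = 0.
  by apply/eqP; rewrite quotv_proj_eq0.
have [f fE] := wedge_universal br bl b0.
have br' u : linear (fun v => quotv_proj (1%VS : {vspace H}) (u * bar v)).
  by move=> a v w; rewrite linearP mulrDr -scalerAr linearP.
have bl' v : linear (fun u => quotv_proj (1%VS : {vspace H}) (u * bar v)).
  by move=> a u w; rewrite mulrDl -scalerAl linearP.
have b0' u : quotv_proj (1%VS : {vspace H}) (u * bar u) = 0.
  by apply/eqP; rewrite quotv_proj_eq0 -normC.
have [f' fE'] := wedge_universal br' bl' b0'.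
(* The sign change makes - f' the map induced by right multiplications. *)
have gE u v : (- f') (wedge u v) = quotv_proj 1%VS (v * bar u).
  by rewrite opp_lfunE fE' (alternating_skew br' bl' b0') opprK.
have lker_opp : lker f' = lker (- f').
  by apply/vspaceP => x; rewrite !memv_ker opp_lfunE oppr_eq0.
exists f, f'; split.
- by split=> // g gP; apply: eq_hom_wedge => u v; rewrite fE gP.
- by split=> // g gP; apply: eq_hom_wedge => u v; rewrite fE' gP.
rewrite /= lker_opp.
exact: (clifford_planes skewH dimH bar_inj barM bar_norm normC bar_tr fE gE).
Qed.
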